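(* Consider the $GI^X/M/c$ queueing model with batch-size probability mass function $b(k)$, $k\ge 1$. Let $p^*(i,j)$ be the one-step transition probabilities of its Markov chain imbedded just before batch arrivals, and let $p(i,j)$ be the one-step transition probabilities of the Markov chain imbedded just before arrivals in the corresponding (single-arrival) $GI/M/c$ model. Then, for all $i,j\ge 0$, \[ p^*(i,j)=\sum_{k=1}^{\infty}p(i+k-1,j)\,b(k). \]
   Context: The $GI/M/c$ model: customers arrive one at a time to an infinite-capacity system with $c\ge 1$ parallel identical servers; inter-arrival times are i.i.d. with distribution function $A(t)$ on $[0,\infty)$; service times are i.i.d. exponential with mean $1/\mu$, independent of the arrivals. $p(i,j)$ is the probability that an arrival finds $j$ customers in the system given that the preceding arrival found $i$ customers (arriving customers not counted in the state they find). The $GI^X/M/c$ model is the same, except that customers arrive in batches: the times between batch arrivals are i.i.d. with distribution function $A(t)$, and batch sizes are i.i.d. copies of a random variable $X$ with support in $\{1,2,\dots\}$ and $b(k)=P(X=k)$; inter-arrival times, batch sizes and service times are mutually independent. $p^*(i,j)$ is the probability that a batch finds $j$ customers in the system given that the preceding batch found $i$ customers. The corresponding $GI/M/c$ model has the same $A$, $c$, $\mu$. *)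

(* Defs.v *)
From HB Require Import structures.
From mathcomp Require Import all_boot all_order all_algebra.
From mathcomp Require Import all_classical all_reals all_analysis.

Set Implicit Arguments.
Unset Strict Implicit.
Unset Printing Implicit Defensive.

Import Order.TTheory GRing.Theory Num.Theory.
Import numFieldNormedType.Exports.

Local Open Scope classical_set_scope.
Local Open Scope ring_scope.

(* The system with c parallel servers and no limit on its capacity.
   Its state is the list of the remaining service requirements of the customers
   present, in order of arrival (first come, first served): the first c entries
   are in service, each at unit rate, the others wait with their requirement
   untouched. [serve c t r] is the state reached from r after a time t without
   arrivals. Either nobody completes service within t, or the clock advances to
   the first completion s, the customers who complete leave and their servers
   take the next waiting customers. For c > 0 each round removes at least one
   customer, so [size r] rounds are enough and the last branch of [serve_rec]
   is never reached. *)
Fixpoint serve_rec (R : realType) (c fuel : nat) (t : R) (r : seq R) : seq R :=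
  let busy := take c r in
  let waiting := drop c r in
  if all (fun x => t < x) busy then [seq x - t | x <- busy] ++ waiting
  else if fuel is fuel'.+1 then
    let s := foldr Num.min (head 0 busy) busy in
    serve_rec c fuel' (t - s) ([seq x - s | x <- busy & s < x] ++ waiting)
  else [::].

Definition serve (R : realType) (c : nat) (t : R) (r : seq R) : seq R :=
  serve_rec c (size r) t r.

(* A sample path. Batch 0 arrives at time 0, t n is the time between the
   arrivals of batches n and n.+1, and x n is the size of batch n.
   Service times are attached to customers: s n.+1 l is that of customer l of
   batch n, and s 0 l that of customer l among the i0 customers that batch 0
   finds (whose services start at time 0 or later).
   [state_found .. n] is the state found by batch n, that batch excluded. *)
Fixpoint state_found (R : realType) (c i0 : nat)
    (t : nat -> R) (x : nat -> nat) (s : nat -> nat -> R) (n : nat) : seq R :=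
  if n is m.+1 then
    serve c (t m) (state_found c i0 t x s m ++ mkseq (s m.+1) (x m))
  else mkseq (s 0%N) i0.

Definition number_found (R : realType) (c i0 : nat)
    (t : nat -> R) (x : nat -> nat) (s : nat -> nat -> R) (n : nat) : nat :=
  size (state_found c i0 t x s n).

Definition mutually_independent (d : measure_display) (Omega : measurableType d)
    (R : realType) (P : probability Omega R)
    (I : eqType) (E : I -> set (set Omega)) : Prop :=
  forall (J : seq I) (B : I -> set Omega), uniq J ->
    (forall i, i \in J -> E i (B i)) ->
    P (\bigcap_(i in [set` J]) B i) = (\prod_(i <- J) P (B i))%E.

Definition events_of (d d' : measure_display) (Omega : measurableType d)
    (T : measurableType d') (Y : Omega -> T) : set (set Omega) :=
  [set Y @^-1` B | B in measurable].

Definition cond_prob (d : measure_display) (Omega : measurableType d)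
    (R : realType) (P : probability Omega R) (B A : set Omega) : R :=
  fine (P (A `&` B)) / fine (P A).

(* The random data of the single-arrival model. *)
Record GIM (R : realType) (A : R -> R) (mu : R)
    (d : measure_display) (Omega : measurableType d)
    (P : probability Omega R) := mkGIM {
  gim_interarrival : nat -> {RV P >-> R};
  gim_service : nat -> nat -> {RV P >-> R};
  gim_interarrival_ge0 : forall t : R, t < 0 -> A t = 0;
  gim_interarrival_cdf : forall n t, cdf (gim_interarrival n) t = (A t)%:E;
  gim_service_exp : forall n l (B : set R), measurable B ->
    distribution P (gim_service n l) B = exponential_prob mu B;
  gim_indep : mutually_independent P (fun k : nat + nat * nat =>
    match k with
    | inl n => events_of (gim_interarrival n)
    | inr (n, l) => events_of (gim_service n l)
    end)
}.

(* The random data of the batch-arrival model; only the values b k with k >= 1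
   are meaningful. *)
Record GIXM (R : realType) (A : R -> R) (mu : R) (b : nat -> R)
    (d : measure_display) (Omega : measurableType d)
    (P : probability Omega R) := mkGIXM {
  gixm_interarrival : nat -> {RV P >-> R};
  gixm_batch : nat -> {RV P >-> nat};
  gixm_service : nat -> nat -> {RV P >-> R};
  gixm_interarrival_ge0 : forall t : R, t < 0 -> A t = 0;
  gixm_interarrival_cdf : forall n t, cdf (gixm_interarrival n) t = (A t)%:E;
  gixm_batch_gt0 : forall n, P [set w | gixm_batch n w = 0%N] = 0%E;
  gixm_batch_pmf : forall n k, (1 <= k)%N ->
    P [set w | gixm_batch n w = k] = (b k)%:E;
  gixm_service_exp : forall n l (B : set R), measurable B ->
    distribution P (gixm_service n l) B = exponential_prob mu B;
  gixm_indep : mutually_independent P (fun k : nat + nat + nat * nat =>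
    match k with
    | inl (inl n) => events_of (gixm_interarrival n)
    | inl (inr n) => events_of (gixm_batch n)
    | inr (n, l) => events_of (gixm_service n l)
    end)
}.

(* Number of customers found by arrival n when arrival 0 finds i0. *)
Definition gim_found (R : realType) (A : R -> R) (mu : R)
    (d : measure_display) (Omega : measurableType d) (P : probability Omega R)
    (M : GIM A mu P) (c i0 n : nat) (w : Omega) : nat :=
  number_found c i0 (fun m => gim_interarrival M m w) (fun=> 1%N)
    (fun m l => gim_service M m l w) n.

Definition gixm_found (R : realType) (A : R -> R) (mu : R) (b : nat -> R)
    (d : measure_display) (Omega : measurableType d) (P : probability Omega R)
    (M : GIXM A mu b P) (c i0 n : nat) (w : Omega) : nat :=
  number_found c i0 (fun m => gixm_interarrival M m w)
    (fun m => gixm_batch M m w) (fun m l => gixm_service M m l w) n.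

(* N i0 n is the state of the imbedded chain at arrival n when it starts in i0;
   p i j is the probability that an arrival finds j given that the preceding
   one found i, whichever the initial state and the arrival are. Letting i0 vary
   makes every state i occur, even one not reachable from an empty system. *)
Definition one_step_transition_probabilities
    (d : measure_display) (Omega : measurableType d)
    (R : realType) (P : probability Omega R)
    (N : nat -> nat -> Omega -> nat) (p : nat -> nat -> R) : Prop :=
  forall i0 n i j : nat, (0 < P [set w | N i0 n w = i])%E ->
    cond_prob P [set w | N i0 n.+1 w = j] [set w | N i0 n w = i] = p i j.

(* Main.v *)
Require Import Defs.
From HB Require Import structures.
From mathcomp Require Import all_boot all_order all_algebra.
From mathcomp Require Import all_classical all_reals all_analysis.
From mathcomp Require Import measurable_realfun.

(** One transition of either chain is a deterministic function of finitely many
independent random variables, and the two models feed the same function with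
data of the same law.

A transition probability may be computed from the chain started in [i] and
observed at arrival 1: the event on which it is conditioned is then sure, so
[p i j] is the plain probability that arrival 1 finds [j] customers
([cond_prob_full]). That number is obtained by serving, during one interarrival
time, a list of service requirements: in the batch model the [i] requirements
of the customers found followed by the [k] requirements of the batch, in the
single-arrival model started in [i + k - 1] those of the customers found
followed by one more. Both lists have length [i + k] and their entries are
independent exponential variables, independent of the interarrival time. Hence,
on the event that the batch has size [k], which is independent of the times,
the batch model finds [j] with probability [b k * p (i + k - 1) j]
([gixm_found_batch]); countable additivity over [k] gives the theorem.

Two facts make this rigorous. The joint law of independent variables is
determined by their marginal laws, because boxes form a pi-system generating
the sigma-algebra of tuples ([eq_law_random_vector]). And the number of
customers left after serving a list is a measurable function of the data
([measurable_size_serve]), because at each departure the list that remains is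
one of countably many sublists, chosen by measurable comparisons. *)

Set Implicit Arguments.
Unset Strict Implicit.
Unset Printing Implicit Defensive.

Import Order.TTheory GRing.Theory Num.Theory.
Import numFieldNormedType.Exports.

Local Open Scope classical_set_scope.
Local Open Scope ring_scope.

(** * Laws of real variables and of tuples *)

(** The rays from [x] to infinity form a pi-system generating the Borel sets,
    and the distribution function gives the measure of their complements. *)
Lemma cdf_inj (R : realType) (d d' : measure_display)
    (Omega : measurableType d) (Omega' : measurableType d')
    (P : probability Omega R) (P' : probability Omega' R)
    (X : {RV P >-> R}) (X' : {RV P' >-> R}) (B : set R) :
  cdf X =1 cdf X' -> measurable B -> P (X @^-1` B) = P' (X' @^-1` B).
Proof.
move=> eqX mB.
rewrite -[LHS]/(distribution P X B) -[RHS]/(distribution P' X' B).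
apply: (measure_unique (@RGenOInfty.G R)
  (fun n : nat => `](- n%:R : R), +oo[%classic)
  (RGenOInfty.measurableE R) _ _ _
  (distribution P X) (distribution P' X')) => //.
- move=> _ _ [x ->] [y ->]; exists (Num.max x y).
  by apply/seteqP; split=> z /=; rewrite !in_itv/= !andbT gt_max => /andP.
- by move=> n; exists (- n%:R).
- rewrite -subTset => x _; exists (Num.bound `|x|) => //=.
  rewrite in_itv/= andbT ltrNl (le_lt_trans (ler_norm _))// normrN.
  exact: archi_boundP.
- move=> _ [x ->]; rewrite -setCitvl.
  change (P (~` (X @^-1` `]-oo, x])) = P' (~` (X' @^-1` `]-oo, x]))).
  rewrite !probability_setC; first by congr (_ - _)%E; exact: eqX.
    exact: measurable_funPTI.
  exact: measurable_funPTI.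
- move=> n.
  exact: le_lt_trans (probability_le1 (distribution P X) _) (ltry _).
Qed.

Section tuple_sigma_algebra.
Context (d : measure_display) (T : measurableType d) (n : nat).

Definition box (B : 'I_n -> set T) : set (n.-tuple T) :=
  [set v | forall i, B i (tnth v i)].

Definition boxes : set (set (n.-tuple T)) :=
  [set box B | B in [set B | forall i, measurable (B i)]].

Lemma boxE (B : 'I_n -> set T) :
  box B = \bigcap_(i in setT) ((fun v : n.-tuple T => tnth v i) @^-1` B i).
Proof. by apply/seteqP; split=> v /= vB i; [move=> _|]; exact: vB. Qed.

Lemma box_measurable (B : 'I_n -> set T) :
  (forall i, measurable (B i)) -> measurable (box B).
Proof.
move=> mB; rewrite boxE; apply: fin_bigcap_measurable => // i _.
by rewrite -[X in measurable X]setTI; exact: measurable_tnth.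
Qed.

Lemma measurable_boxes : @measurable _ (n.-tuple T) = <<s boxes >>.
Proof.
apply/seteqP; split; last first.
  apply: smallest_sub; first exact: sigma_algebra_measurable.
  by move=> _ [B mB <-]; exact: box_measurable.
apply: smallest_sub; first exact: smallest_sigma_algebra.
move=> S; rewrite -bigcup_seq => -[i _ [B mB <-]].
apply: sub_sigma_algebra; rewrite setTI.
exists (fun k => if k == i then B else setT) => [k|/=].
  by case: ifP.
apply/seteqP; split=> v /=; first by move/(_ i); rewrite eqxx.
by move=> vB k; case: eqP => // ->.
Qed.

Lemma eq_measure_boxes (R : realType)
    (m1 m2 : {measure set (n.-tuple T) -> \bar R}) :
  (m1 setT < +oo)%E ->
  (forall B, (forall i, measurable (B i)) -> m1 (box B) = m2 (box B)) ->
  forall S, measurable S -> m1 S = m2 S.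
Proof.
move=> m1oo m12; apply: (measure_unique boxes (fun=> setT)) => //.
- exact: measurable_boxes.
- move=> _ _ [B mB <-] [C mC <-]; exists (fun i => B i `&` C i).
    by move=> i; exact: measurableI.
  apply/seteqP; split=> v /=; first by move=> BC; split=> i; case: (BC i).
  by move=> [vB vC] i; split.
- by move=> _; exists (fun=> setT) => //; apply/seteqP; split.
- by rewrite bigcup_const.
- by move=> _ [B mB <-]; exact: m12.
Qed.

End tuple_sigma_algebra.

Lemma measurable_mktuple (d d' : measure_display) (Omega : measurableType d)
    (T : measurableType d') (n : nat) (Z : 'I_n -> {mfun Omega >-> T}) :
  measurable_fun setT (fun w => [tuple Z m w | m < n]).
Proof.
apply/measurable_fun_tnthP => m.
by apply: (eq_measurable_fun (Z m)) => // w _; rewrite /= tnth_mktuple.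
Qed.

(** * Independent families *)

(** Independence is postulated for duplicate-free lists of indices; this form,
    over an injectively indexed finite family, is the one that random vectors
    use. *)
Lemma independent_prod (d : measure_display) (Omega : measurableType d)
    (R : realType) (P : probability Omega R)
    (I : eqType) (E : I -> set (set Omega))
    (J : finType) (idx : J -> I) (F : J -> set Omega) :
  mutually_independent P E -> injective idx ->
  (forall j, E (idx j) (F j)) ->
  P (\bigcap_(j in setT) F j) = (\prod_(j : J) P (F j))%E.
Proof.
move=> indP idx_inj EF.
pose G k := \bigcap_(j in [set j | idx j = k]) F j.
have GE j : G (idx j) = F j.
  apply/seteqP; split=> [w Gw|w Fw j' /= /idx_inj ->//].
  exact: Gw.
have := indP [seq idx j | j <- enum J] G.
rewrite map_inj_uniq// enum_uniq big_map => /(_ isT) indG.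
rewrite -big_enum/= -(eq_bigr _ (fun j _ => congr1 P (GE j))) -indG.
  congr (P _); apply/seteqP; split=> w Fw.
    by move=> k /= /mapP[j _ ->]; rewrite GE; exact: Fw.
  by move=> j _; rewrite -GE; apply: Fw; rewrite /= map_f// mem_enum.
by move=> k /mapP[j _ ->]; rewrite GE.
Qed.

(** The law of a vector of independent variables depends on the marginal laws
    only, and an event independent of the vector factors out. The measures
    [S |-> P' (Y' in S, D)] and [S |-> beta * P (Y in S)] are compared on boxes,
    where both are products. *)
Lemma eq_law_random_vector (R : realType) (d d' : measure_display)
    (Omega : measurableType d) (Omega' : measurableType d')
    (P : probability Omega R) (P' : probability Omega' R)
    (I I' : eqType) (E : I -> set (set Omega)) (E' : I' -> set (set Omega'))
    (n : nat) (idx : 'I_n -> I) (idx' : 'I_n -> I')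
    (Z : 'I_n -> {RV P >-> R}) (Z' : 'I_n -> {RV P' >-> R})
    (k' : I') (D : set Omega') (beta : R) (S : set (n.-tuple R)) :
  mutually_independent P E -> mutually_independent P' E' ->
  injective idx -> injective idx' -> (forall m, idx' m != k') ->
  (forall m, events_of (Z m) `<=` E (idx m)) ->
  (forall m, events_of (Z' m) `<=` E' (idx' m)) ->
  E' k' D -> measurable D -> P' D = beta%:E ->
  (forall m B, measurable B -> P (Z m @^-1` B) = P' (Z' m @^-1` B)) ->
  measurable S ->
  P' ([set w | S [tuple Z' m w | m < n]] `&` D) =
    (beta%:E * P [set w | S [tuple Z m w | m < n]])%E.
Proof.
move=> indP indP' idx_inj idx'_inj idx'k EZ EZ' ED mD PD eqZ mS.
pose Y w := [tuple Z m w | m < n].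
pose Y' w := [tuple Z' m w | m < n].
have mY : measurable_fun setT Y by exact: measurable_mktuple.
have mY' : measurable_fun setT Y' by exact: measurable_mktuple.
have beta_ge0 : 0 <= beta by rewrite -lee_fin -PD.
(* A pushforward is a measure only along a measurable map, so [m1] and [m2] take
   a measurability proof as argument. *)
pose m1 : {measure set (n.-tuple R) -> \bar R} := pushforward (mrestr P' mD) Y'.
pose m2 : {measure set (n.-tuple R) -> \bar R} :=
  pushforward (mscale (NngNum beta_ge0) P) Y.
rewrite -[LHS]/(m1 mY' S) -[RHS]/(m2 mY S).
apply: (@eq_measure_boxes _ _ _ R (m1 mY') (m2 mY)) => // [|B mB].
  rewrite /m1 /= /pushforward /mrestr preimage_setT setTI PD.
  exact: ltry.
rewrite /m1 /m2 /= /pushforward /mrestr /mscale/=.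
have -> : Y @^-1` box B = \bigcap_(m in setT) (Z m @^-1` B m).
  apply/seteqP; split=> w /= wB m.
    by move=> _; move: (wB m); rewrite tnth_mktuple.
  by rewrite tnth_mktuple; exact: wB.
rewrite (independent_prod indP idx_inj); last first.
  by move=> m; apply: EZ; exists (B m).
(* In the second model the index [None] stands for the extra event [D]. *)
pose idxo o := if o is Some m then idx' m else k'.
pose F o := if o is Some m then Z' m @^-1` B m else D.
have -> : Y' @^-1` box B `&` D = \bigcap_(o in setT) F o.
  apply/seteqP; split=> [w /= [wB Dw] [m|] _ //=|w /= wF].
    by move: (wB m); rewrite tnth_mktuple.
  split; last exact: (wF None).
  by move=> m; rewrite tnth_mktuple; exact: (wF (Some m)).
rewrite (@independent_prod _ _ _ _ _ _ _ idxo _ indP'); last 2 first.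
- move=> [m|] [m'|] //=.
  + by move/idx'_inj ->.
  + by move/eqP; rewrite (negbTE (idx'k _)).
  + by move/esym/eqP; rewrite (negbTE (idx'k _)).
- by move=> [m|] //=; apply: EZ'; exists (B m).
rewrite (bigD1 None)//= PD; congr (_ * _)%E.
rewrite (reindex_omap Some id)/=; last by case.
by apply: eq_big => [m|m _] /=; rewrite ?eqxx// eqZ.
Qed.

(** * Measurability of the service dynamics *)

Section serve_measurable.
Context (d : measure_display) (T : measurableType d) (R : realType).
Implicit Types (f g : {mfun T >-> R}) (r : seq {mfun T >-> R}).

(** A random list of fixed length is a list of random variables; working in the
    ring of measurable functions, the entries stay measurable through the whole
    recursion by typing alone. *)
Definition evals r (w : T) : seq R := [seq f w | f : {mfun T >-> R} <- r].

Definition min_mfun f g : {mfun T >-> R} :=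
  HB.pack (f \min g) (isMeasurableFun.Build _ _ _ _ (f \min g)
    (measurable_minr (measurable_funPT f) (measurable_funPT g))).

Lemma measurable_ltr_mfun f g (x : bool) : measurable [set w | (f w < g w) = x].
Proof.
have := @measurable_fun_ltr _ _ _ setT f g.
move=> /(_ (measurable_funPT f) (measurable_funPT g) measurableT [set x]).
by rewrite setTI; exact.
Qed.

Lemma measurable_mask g r (m : bitseq) :
  measurable [set w | [seq g w < f w | f : {mfun T >-> R} <- r] = m].
Proof.
elim: r m => [|f r IH] [|x m] /=.
- by rewrite [X in measurable X](_ : _ = setT)//; apply/seteqP; split.
- by rewrite [X in measurable X](_ : _ = set0)//; apply/seteqP; split.
- by rewrite [X in measurable X](_ : _ = set0)//; apply/seteqP; split.
- rewrite [X in measurable X](_ : _ = [set w | (g w < f w) = x] `&`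
      [set w | [seq g w < f w | f : {mfun T >-> R} <- r] = m]).
    by apply: measurableI => //; exact: measurable_ltr_mfun.
  by apply/seteqP; split=> w /= [-> ->].
Qed.

Lemma measurable_all_gt g r :
  measurable_fun setT (fun w => all (fun x => g w < x) (evals r w)).
Proof.
apply: (measurable_fun_bool true); rewrite setTI.
rewrite [X in measurable X](_ : _ = [set w |
    [seq g w < f w | f : {mfun T >-> R} <- r] = nseq (size r) true]).
  exact: measurable_mask.
apply/seteqP; split=> w /=; elim: r => //= f r IH.
  by move=> /andP[-> /IH ->].
by move=> [-> /IH ->].
Qed.

(** The length of the list varies with the sample point, so it is decomposed
    according to the Boolean mask of the customers who stay in service at the
    first departure: on each of these countably many measurable events, the
    remaining list is a fixed list of random variables, to which the induction
    on the fuel applies. *)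
Lemma measurable_size_serve_rec c fuel (t : {mfun T >-> R}) r :
  measurable_fun setT (fun w => size (serve_rec c fuel (t w) (evals r w))).
Proof.
elim: fuel t r => [|fuel IH] t r.
  apply: (eq_measurable_fun (fun w =>
    if all (fun x => t w < x) (evals (take c r) w) then size r else 0%N)).
    move=> w _ /=; rewrite /evals -map_take; case: ifP => _ //.
    rewrite size_cat !size_map size_drop size_map -size_drop -size_cat.
    by rewrite cat_take_drop.
  by apply: measurable_fun_ifT => //; exact: measurable_all_gt.
set b := take c r.
pose s : {mfun T >-> R} := foldr min_mfun (head 0 b) b.
pose next (m : bitseq) : seq {mfun T >-> R} :=
  [seq f - s | f : {mfun T >-> R} <- mask m b] ++ drop c r.
pose stay w := [seq s w < f w | f : {mfun T >-> R} <- b].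
pose G w := size (serve_rec c fuel ((t - s) w) (evals (next (stay w)) w)).
apply: (eq_measurable_fun (fun w =>
    if all (fun x => t w < x) (evals b w) then size r else G w)).
  move=> w _; rewrite [RHS]/= /evals -map_take -map_drop -/b.
  case: ifP => _.
    by rewrite size_cat !size_map -size_cat cat_take_drop.
  (* The default value of [head] is the zero function, whose values are the
     default value 0 used pointwise. *)
  have -> : foldr Num.min (head 0 [seq f w | f : {mfun T >-> R} <- b])
      [seq f w | f : {mfun T >-> R} <- b] = s w.
    have -> : head 0 [seq f w | f : {mfun T >-> R} <- b] = (head 0 b) w.
      by case: (b).
    rewrite /s.
    by move: (head 0 b) => z; elim: (b) => //= f b' ->.
  congr (size (serve_rec _ _ _ _)).
  rewrite /evals /next map_cat -map_comp; congr (_ ++ _).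
  by rewrite filter_mask -map_comp -map_mask -map_comp.
apply: measurable_fun_ifT => //; first exact: measurable_all_gt.
move=> _ Y mY; rewrite setTI.
rewrite [X in measurable X](_ : _ = \bigcup_(m : bitseq)
   ([set w | stay w = m] `&`
    (fun w => size (serve_rec c fuel ((t - s) w) (evals (next m) w))) @^-1` Y)).
  apply: countable_bigcupT_measurable => // m.
  apply: measurableI; first exact: measurable_mask.
  by rewrite -[X in measurable X]setTI; exact: IH.
apply/seteqP; split=> w /=; first by move=> Gw; exists (stay w).
by move=> [m _ [/= mE]]; rewrite /G mE.
Qed.

End serve_measurable.

Lemma measurable_size_serve (R : realType) (c n : nat) :
  measurable_fun setT
    (fun v : n.+1.-tuple R => size (serve c (thead v) (behead v))).
Proof.
pose proj (m : 'I_n.+1) : {mfun n.+1.-tuple R >-> R} :=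
  HB.pack (fun v : n.+1.-tuple R => tnth v m)
    (isMeasurableFun.Build _ _ _ _ (fun v : n.+1.-tuple R => tnth v m)
      (measurable_tnth m)).
have := measurable_size_serve_rec c n (proj ord0)
  (behead [seq proj m | m <- enum 'I_n.+1]).
apply: eq_measurable_fun => v _; rewrite /serve size_behead size_tuple.
congr (size (serve_rec _ _ _ _)).
by rewrite /evals -behead_map -map_comp -[in RHS](map_tnth_enum v).
Qed.

(** * One step of the imbedded chains *)

(** The label in the service array of the [l]-th customer present just after
    batch 0 has joined [i] customers: row 0 lists the customers found and row 1
    those of batch 0. *)
Definition customer (i l : nat) : nat * nat :=
  if (l < i)%N then (0, l)%N else (1, l - i)%N.

Lemma customer_inj i : injective (customer i).
Proof.
move=> l l'; rewrite /customer; case: ltnP => li; case: ltnP => l'i //= [] //.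
by move=> ll'; rewrite -(subnKC li) -(subnKC l'i) ll'.
Qed.

(** The data of one step as a single sequence: the interarrival time at rank 0,
    then the service times in the order of arrival. The type [V] is generic so
    that the same definition describes the variables, their values, and their
    indices in the independent family ([step_index]). *)
Definition step_data (V : Type) (i : nat) (t : V) (s : nat -> nat -> V)
    (m : nat) : V :=
  if m is l.+1 then s (customer i l).1 (customer i l).2 else t.

Definition step_index (V : Type) (i : nat) (t : V) : nat -> V + nat * nat :=
  step_data i (inl t) (fun n l => inr (n, l)).

Lemma step_index_inj V i (t : V) : injective (step_index i t).
Proof.
move=> [|l] [|l'] //=; rewrite /step_index/= -!surjective_pairing.
by move=> [/customer_inj ->].
Qed.

Lemma number_found1 (R : realType) (c i n : nat) (t : nat -> R)
    (x : nat -> nat) (s : nat -> nat -> R) (v : n.+1.-tuple R) :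
  n = (i + x 0)%N -> v = [tuple step_data i (t 0%N) s m | m < n.+1] ->
  number_found c i t x s 1 = size (serve c (thead v) (behead v)).
Proof.
move=> nE ->; rewrite /number_found/=; congr (size (serve _ _ _)).
  by rewrite /thead tnth_mktuple.
rewrite /= enum_ordSl/= -map_comp nE.
apply: (@eq_from_nth _ 0) => [|l].
  by rewrite size_cat !size_mkseq size_map size_enum_ord.
rewrite size_cat !size_mkseq => ln.
rewrite (nth_map (Ordinal ln)) ?size_enum_ord//=.
rewrite nth_cat size_mkseq /customer /bump/= nth_enum_ord//.
case: ltnP => li; first by rewrite nth_mkseq.
by rewrite nth_mkseq// ltn_subLR.
Qed.

(** The chain starts in [i] surely, so conditioning on its initial state changes
    nothing. *)
Lemma cond_prob_full (d : measure_display) (Omega : measurableType d)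
    (R : realType) (P : probability Omega R) (N : nat -> nat -> Omega -> nat)
    (p : nat -> nat -> R) (i j : nat) :
  (forall w, N i 0%N w = i) -> measurable [set w | N i 1%N w = j] ->
  one_step_transition_probabilities P N p ->
  (p i j)%:E = P [set w | N i 1%N w = j].
Proof.
move=> N0 mN pP.
have N0T : [set w | N i 0%N w = i] = setT by apply/seteqP; split=> w //= _.
have := pP i 0%N i j; rewrite /cond_prob N0T setTI probability_setT lte01.
by move=> /(_ isT) <-; rewrite divr1 fineK// fin_num_measure.
Qed.

Section found_after_one_step.
Context (R : realType) (A : R -> R) (c : nat) (mu : R) (b : nat -> R)
  (d : measure_display) (Omega : measurableType d) (P : probability Omega R)
  (M : GIM A mu P)
  (d' : measure_display) (Omega' : measurableType d')
  (P' : probability Omega' R) (M' : GIXM A mu b P').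

Definition gim_data (i m : nat) : {RV P >-> R} :=
  step_data i (gim_interarrival M 0) (gim_service M) m.

Definition gixm_data (i m : nat) : {RV P' >-> R} :=
  step_data i (gixm_interarrival M' 0) (gixm_service M') m.

Definition found_set n (j : nat) : set (n.+1.-tuple R) :=
  [set v | size (serve c (thead v) (behead v)) = j].

Lemma measurable_found_set n j : measurable (@found_set n j).
Proof.
rewrite -[X in measurable X]setTI.
exact: (@measurable_size_serve R c n measurableT [set j]).
Qed.

(** The length [n] is kept apart from [i.+1] so that this tuple and that of the
    batch model, of length [(i + k.+1).+1], get the same type. *)
Lemma gim_foundE i n j (nE : n = i.+1) :
  [set w | gim_found M c i 1 w = j] =
  [set w | found_set j [tuple gim_data i m w | m < n.+1]].
Proof.
apply/seteqP; split=> w /=; rewrite /found_set/= /gim_found;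
  rewrite (@number_found1 _ _ _ n _ _ _
    [tuple gim_data i m w | m < n.+1]) ?addn1//;
  by apply: eq_mktuple => -[[|l] lm].
Qed.

Lemma gixm_foundE i k j :
  [set w | gixm_found M' c i 1 w = j] `&` [set w | gixm_batch M' 0 w = k] =
  [set w | found_set j [tuple gixm_data i m w | m < (i + k).+1]] `&`
    [set w | gixm_batch M' 0 w = k].
Proof.
apply/seteqP; split=> w /= [+ wk]; rewrite /found_set/= /gixm_found;
  rewrite (@number_found1 _ _ _ (i + k) _ _ _
    [tuple gixm_data i m w | m < (i + k).+1]) ?wk//;
  by apply: eq_mktuple => -[[|l] lm].
Qed.

Lemma measurable_gim_found i j : measurable [set w | gim_found M c i 1 w = j].
Proof.
rewrite (gim_foundE _ erefl) -[X in measurable X]setTI.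
by apply: (@measurable_mktuple _ _ _ _ i.+2 (fun m => gim_data i m)) => //;
  exact: measurable_found_set.
Qed.

Lemma measurable_batch k : measurable [set w | gixm_batch M' 0 w = k].
Proof.
rewrite -[X in measurable X]setTI.
exact: (measurable_funPT (gixm_batch M' 0) measurableT [set k]).
Qed.

Lemma measurable_gixm_found_batch i j k :
  measurable ([set w | gixm_found M' c i 1 w = j] `&`
    [set w | gixm_batch M' 0 w = k]).
Proof.
rewrite gixm_foundE; apply: measurableI; last exact: measurable_batch.
rewrite -[X in measurable X]setTI.
by apply: (@measurable_mktuple _ _ _ _ (i + k).+1
  (fun m => gixm_data i m)) => //;
  exact: measurable_found_set.
Qed.

Lemma gixm_found_bigcup i j :
  [set w | gixm_found M' c i 1 w = j] =
  \bigcup_k ([set w | gixm_found M' c i 1 w = j] `&`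
    [set w | gixm_batch M' 0 w = k]).
Proof.
apply/seteqP; split=> w; last by case=> k _ [].
by move=> wj; exists (gixm_batch M' 0 w).
Qed.

Lemma measurable_gixm_found i j :
  measurable [set w | gixm_found M' c i 1 w = j].
Proof.
rewrite gixm_found_bigcup; apply: bigcupT_measurable => k.
exact: measurable_gixm_found_batch.
Qed.

(** A batch of size [k.+1] joining [i] customers and a single arrival joining
    [i + k] customers both leave [i + k.+1] customers with fresh service times,
    so the data of the two steps have the same law. *)
Lemma gixm_found_batch i k j :
  P' ([set w | gixm_found M' c i 1 w = j] `&`
      [set w | gixm_batch M' 0 w = k.+1]) =
  ((b k.+1)%:E * P [set w | gim_found M c (i + k) 1 w = j])%E.
Proof.
rewrite gixm_foundE (gim_foundE _ (addnS i k)).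
apply: (eq_law_random_vector
  (@gim_indep _ _ _ _ _ _ M) (@gixm_indep _ _ _ _ _ _ _ M')
  (idx := fun m : 'I_(i + k.+1).+1 => step_index (i + k) 0%N m)
  (idx' := fun m : 'I_(i + k.+1).+1 => step_index i (inl 0%N) m)
  (k' := inl (inr 0%N)) (S := @found_set (i + k.+1) j)
  (Z := fun m : 'I_(i + k.+1).+1 => gim_data (i + k) m)
  (Z' := fun m : 'I_(i + k.+1).+1 => gixm_data i m)).
- by move=> m m' /(@step_index_inj _ _ _ m m') /ord_inj.
- by move=> m m' /(@step_index_inj _ _ _ m m') /ord_inj.
- by case=> -[|l].
- by case=> -[|l] lm; exact: subset_refl.
- by case=> -[|l] lm; exact: subset_refl.
- by exists [set k.+1].
- exact: measurable_batch.
- exact: gixm_batch_pmf.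
- case=> -[|l] _ B mB /=.
    apply: cdf_inj mB => t.
    by rewrite gim_interarrival_cdf gixm_interarrival_cdf.
  have := gim_service_exp M (customer (i + k) l).1 (customer (i + k) l).2 mB.
  by rewrite -(gixm_service_exp M' (customer i l).1 (customer i l).2 mB).
- exact: measurable_found_set.
Qed.

End found_after_one_step.

Theorem lemma3p1 (R : realType) (A : R -> R) (c : nat) (mu : R) (b : nat -> R)
    (hc : (1 <= c)%N) (hmu : 0 < mu)
    (d : measure_display) (Omega : measurableType d) (P : probability Omega R)
    (M : GIM A mu P)
    (d' : measure_display) (Omega' : measurableType d')
    (P' : probability Omega' R) (M' : GIXM A mu b P')
    (p pstar : nat -> nat -> R)
    (hp : one_step_transition_probabilities P (gim_found M c) p)
    (hpstar : one_step_transition_probabilities P' (gixm_found M' c) pstar)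
    (i j : nat) :
  (pstar i j)%:E = (\sum_(1 <= k <oo) (p (i + k - 1)%N j * b k)%:E)%E.
Proof.
rewrite (cond_prob_full _ _ hpstar); last 2 first.
- by move=> w; rewrite /gixm_found/number_found size_mkseq.
- exact: measurable_gixm_found.
rewrite gixm_found_bigcup measure_bigcup; last 2 first.
- by move=> k _; exact: measurable_gixm_found_batch.
- by move=> k l _ _ [w /= [[_ <-] [_ <-]]].
(* A batch is almost surely nonempty, so the term of size 0 vanishes. *)
rewrite nneseries_recl ?in_setT//.
rewrite [X in (X + _)%E](_ : _ = 0%E) ?add0e; last first.
  apply: (subset_measure0 _ _ _ (gixm_batch_gt0 M' 0)).
  - exact: measurable_gixm_found_batch.
  - exact: measurable_batch.
  - exact: subIsetr.
rewrite (eq_eseriesl (Q := xpredT)); last by move=> k; rewrite in_setT.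
rewrite eseries_cond [RHS]eseries_cond.
apply: eq_eseriesr => -[|k] //.
move=> _ /=; rewrite (gixm_found_batch _ M) addnS subn1/= EFinM.
rewrite (cond_prob_full _ _ hp) 1?muleC//.
- by move=> w; rewrite /gim_found/number_found size_mkseq.
- exact: measurable_gim_found.
Qed.
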